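(* Let $o$ be (one component of) the ODE-RNN output on $\Pi: a=t_0<t_1<\dots<t_n=b$ with scalar observations $x_0,\dots,x_n$. Define the jumps $$\dot r_k=\dot o(t_k^+)-\dot o(t_k^-),\qquad \ddot r_k=\ddot o(t_k^+)-\ddot o(t_k^-),$$ where $\dot o$ and $\ddot o$ are given by $$\dot o=\frac{\partial g}{\partial \mathbf h}^{\top} f,\qquad \ddot o=f^{\top}\frac{\partial^2 g}{\partial \mathbf h^2}f+\frac{\partial g}{\partial \mathbf h}^{\top}\frac{\partial f}{\partial \mathbf h}f ,$$ and define the errors $\epsilon_k^+=x_k-o(t_k^+)$ and $\epsilon_k^-=x_k-o(t_k^-)$. Let $\tau_k=t_{k+1}-t_k$, $\mu_k=\frac{\tau_{k-1}}{\tau_{k-1}+\tau_k}$, $\lambda_k=\frac{\tau_k}{\tau_{k-1}+\tau_k}$, $\epsilon[t_k^+,t_{k+1}^-]=\frac{\epsilon_{k+1}^--\epsilon_k^+}{\tau_k}$, and $$d_k=6\,\frac{\epsilon[t_k^+,t_{k+1}^-]-\epsilon[t_{k-1}^+,t_k^-]}{\tau_{k-1}+\tau_k}+\frac{6\dot r_k-2\ddot r_k\tau_{k-1}-\ddot r_{k+1}\tau_k}{\tau_{k-1}+\tau_k},\qquad k=1,\dots,n-1 .$$ Then the piecewise cubic compensation $c$ (with pieces $c_k$ on $[t_k,t_{k+1})$, $k=0,\dots,n-1$) for which $\hat o=c+o$ satisfies the four smoothing constraints (1)-(4) is uniquely determined, and $$c_k(t)=\frac{M_{k+1}+\ddot r_{k+1}-M_k}{6\tau_k}(t-t_k)^3+\frac{M_k}{2}(t-t_k)^2+\Big(\frac{\epsilon_{k+1}^--\epsilon_k^+}{\tau_k}-\frac{\tau_k(M_{k+1}+\ddot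 r_{k+1}+2M_k)}{6}\Big)(t-t_k)+\epsilon_k^+ ,$$ where $M_0=M_n=0$ and $\mathbf M=(M_1,\dots,M_{n-1})^{\top}$ is given by $\mathbf M=A^{-1}\mathbf d$ with $\mathbf d=(d_1,\dots,d_{n-1})^{\top}$ and $A$ the $(n-1)\times(n-1)$ tridiagonal matrix $$A=\begin{pmatrix}2&\lambda_1&&&\\ \mu_2&2&\lambda_2&&\\ &\ddots&\ddots&\ddots&\\ &&\mu_{n-2}&2&\lambda_{n-2}\\ &&&\mu_{n-1}&2\end{pmatrix}.$$
   Context: ODE-RNN. Observations are taken at times $a=t_0<t_1<\dots<t_n=b$. The hidden state $\mathbf h(t)\in\mathbb R^m$ evolves on each $[t_k,t_{k+1})$ by the ODE $\dot{\mathbf h}(t)=f(\mathbf h(t))$, with $f:\mathbb R^m\to\mathbb R^m$ and initial value $\mathbf h(t_k)$, and the output is $o(t)=g(\mathbf h(t))$. At each observation time the hidden state is reset by $\mathbf h(t_k)=\mathrm{RNNCell}(\mathbf h(t_k^-),\mathbf x_k)$, where $\mathrm{RNNCell}$ is some fixed map, so that $\mathbf h$ and $o$ are right-continuous but may jump at $t_k$. All quantities are considered for one output dimension at a time: $g:\mathbb R^m\to\mathbb R$ and $x_k\in\mathbb R$ denote the corresponding component of the output map and of the observation. The function $f$ is assumed $C^1$ and $g$ is assumed $C^2$. Dots denote time derivatives; $t_k^-$, $t_k^+$ denote left and right limits at $t_k$. $\frac{\partial g}{\partial \mathbf h}$ is the gradient (column vector), $\frac{\partial^2 g}{\partial\mathbf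 h^2}$ the Hessian, $\frac{\partial f}{\partial\mathbf h}$ the Jacobian, all evaluated at $\mathbf h(t)$. Values at $t_n^+$ are those computed from the updated hidden state $\mathbf h(t_n)$. Compensation. $\hat o(t)=c(t)+o(t)$, where $c$ is piecewise cubic, i.e. on $[t_k,t_{k+1})$ it equals a polynomial $c_k$ of degree at most $3$, $k=0,\dots,n-1$. At the right endpoint $t_n$, conditions on $\hat o$ are understood as left limits at $t_n$. Smoothing constraints on $\hat o$: (1) $\hat o(t_k^-)=\hat o(t_k^+)=x_k$ for $k=1,\dots,n-1$, $\hat o(t_0)=x_0$, $\hat o(t_n)=x_n$; (2) $\dot{\hat o}(t_k^-)=\dot{\hat o}(t_k^+)$ for $k=1,\dots,n-1$; (3) $\ddot{\hat o}(t_k^-)=\ddot{\hat o}(t_k^+)$ for $k=1,\dots,n-1$; (4) $\ddot{\hat o}(t_0)=\ddot{\hat o}(t_n)=0$.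
   Formalization: With M_0=M_n=0 the formula meets (4) only if ö(t_0)=ö(t_n^+)=0; this is proved as an exact condition. In general M_0=-ö(t_0), M_n=-ö(t_n^+), with μ_1M_0 and λ_{n-1}M_n subtracted from d; M_0=M_n=0 is also shown to solve (1)-(3) with c''(t_0)=0, c''(t_n^-)=r̈_n. *)

(* Defs.v *)
From HB Require Import structures.
From mathcomp Require Import all_boot all_order all_algebra.
From mathcomp Require Import all_classical all_reals all_analysis.

Set Implicit Arguments.
Unset Strict Implicit.
Unset Printing Implicit Defensive.

Import Order.TTheory GRing.Theory Num.Theory.
Import numFieldNormedType.Exports.

Local Open Scope classical_set_scope.
Local Open Scope ring_scope.

Section Calculus.
Context {R : realType} {m : nat}.
Implicit Types (f : 'cV[R]_m -> 'cV[R]_m) (g : 'cV[R]_m -> R).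

Definition partial {V : normedModType R} (F : 'cV[R]_m -> V) (i : 'I_m)
    (x : 'cV[R]_m) : V :=
  'D_(delta_mx i ord0 : 'cV[R]_m) F x.

Definition is_C1 {V : normedModType R} (F : 'cV[R]_m -> V) : Prop :=
  (forall x, differentiable F x) /\ (forall i, continuous (partial F i)).

Definition is_C2 g : Prop := is_C1 g /\ forall i, is_C1 (partial g i).

Definition gradient g (x : 'cV[R]_m) : 'cV[R]_m := \col_i partial g i x.

Definition hessian g (x : 'cV[R]_m) : 'M[R]_m :=
  \matrix_(i, j) partial (partial g j) i x.

(* The library's [jacobian] acts on row vectors, hence is the transpose of the
   column-vector Jacobian used here. *)
Definition jacobian_col f (x : 'cV[R]_m) : 'M[R]_m :=
  \matrix_(i, j) partial f j x i ord0.

(* First and second time derivatives of [g (h t)] along [h' = f h], as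
   functions of the state; the 1 x 1 products are read as scalars. *)
Definition output_d1 f g (x : 'cV[R]_m) : R :=
  ((gradient g x)^T *m f x) ord0 ord0.

Definition output_d2 f g (x : 'cV[R]_m) : R :=
  ((f x)^T *m hessian g x *m f x
   + (gradient g x)^T *m jacobian_col f x *m f x) ord0 ord0.

End Calculus.

Section OdeRnn.
Context {R : realType} {m p : nat}.

(* The ODE is imposed in the open interval and the initial value [h (t k)] by
   right-continuity.  [cell] receives the whole observation vector.  No reset
   is imposed at [t 0], where there is no left limit: [h (t 0)] is arbitrary. *)
Definition ode_rnn (f : 'cV[R]_m -> 'cV[R]_m)
    (cell : 'cV[R]_m -> 'cV[R]_p -> 'cV[R]_m) (n : nat) (t : nat -> R)
    (X : nat -> 'cV[R]_p) (h : R -> 'cV[R]_m) : Prop :=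
  forall k, (k < n)%N ->
  [/\ forall s, s \in `]t k, t k.+1[ -> is_derive s (1 : R) h (f (h s)),
      h s @[s --> (t k)^'+] --> h (t k),
      cvg (h s @[s --> (t k.+1)^'-]) &
      h (t k.+1) = cell (lim (h s @[s --> (t k.+1)^'-])) (X k.+1)].

End OdeRnn.

Section Compensation.
Context {R : realType}.
Variables (n : nat) (t x : nat -> R).

(* [o] is the output, [o1] and [o2] its first and second time derivatives. *)
Variables (o o1 o2 : R -> R).

(* These three functions of the hidden state are right-continuous on [t 0, t n[
   and the value at t_n^+ is by convention that of the updated state, so
   F(t_k^+) is written [F (t k)] for every k <= n. *)
Definition left_lim (F : R -> R) (s0 : R) : R := lim (F s @[s --> s0^'-]).
Definition jump (F : R -> R) (k : nat) : R := F (t k) - left_lim F (t k).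

Definition eps_plus (k : nat) : R := x k - o (t k).
Definition eps_minus (k : nat) : R := x k - left_lim o (t k).

Definition tau (k : nat) : R := t k.+1 - t k.
Definition mu (k : nat) : R := tau k.-1 / (tau k.-1 + tau k).
Definition lambda (k : nat) : R := tau k / (tau k.-1 + tau k).

Definition eps_slope (k : nat) : R := (eps_minus k.+1 - eps_plus k) / tau k.

Definition dcoef (k : nat) : R :=
  6 * ((eps_slope k - eps_slope k.-1) / (tau k.-1 + tau k))
  + (6 * jump o1 k - 2 * jump o2 k * tau k.-1 - jump o2 k.+1 * tau k)
    / (tau k.-1 + tau k).

(* Row and column [i] stand for the index k = i + 1 of 1, ..., n - 1. *)
Definition Amx : 'M[R]_n.-1 :=
  \matrix_(i, j)
    (if j == i :> nat then 2
     else if j == i.+1 :> nat then lambda i.+1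
     else if i == j.+1 :> nat then mu i.+1
     else 0).

Definition dvec : 'cV[R]_n.-1 := \col_i dcoef i.+1.

(* Terms of the first and last equation of the tridiagonal system involving the
   end values [M0] and [Mn] when these are not zero. *)
Definition end_terms (M0 Mn : R) : 'cV[R]_n.-1 :=
  \col_i ((if i == 0%N :> nat then mu 1%N * M0 else 0)
          + (if i.+2 == n :> nat then lambda n.-1 * Mn else 0)).

Definition cubic_piece (M : nat -> R) (k : nat) (s : R) : R :=
  (M k.+1 + jump o2 k.+1 - M k) / (6 * tau k) * (s - t k) ^+ 3
  + M k / 2 * (s - t k) ^+ 2
  + ((eps_minus k.+1 - eps_plus k) / tau k
     - tau k * (M k.+1 + jump o2 k.+1 + 2 * M k) / 6) * (s - t k)
  + eps_plus k.

Definition piecewise_cubic (c : R -> R) : Prop :=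
  forall k, (k < n)%N ->
  exists2 P : {poly R}, (size P <= 4)%N &
    forall s, s \in `[t k, t k.+1[ -> c s = P.[s].

Definition interpolates (y : R -> R) : Prop :=
  [/\ forall k, (0 < k < n)%N ->
        y s @[s --> (t k)^'-] --> x k /\ y s @[s --> (t k)^'+] --> x k,
      y (t 0%N) = x 0%N &
      y s @[s --> (t n)^'-] --> x n].

(* The left and right limits of [F] exist and agree at the interior nodes. *)
Definition matches_at_nodes (F : R -> R) : Prop :=
  forall k, (0 < k < n)%N ->
  exists l : R, F s @[s --> (t k)^'-] --> l /\ F s @[s --> (t k)^'+] --> l.

(* Constraints on [F] at both ends, [t 0] from the right and [t n] from the
   left. *)
Definition end_values (F : R -> R) (u v : R) : Prop :=
  F s @[s --> (t 0%N)^'+] --> u /\ F s @[s --> (t n)^'-] --> v.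

Definition smooth_inside (c : R -> R) : Prop :=
  let y := c \+ o in
  [/\ piecewise_cubic c, interpolates y,
      matches_at_nodes (derive1 y) & matches_at_nodes (derive1n 2 y)].

Definition smoothing (c : R -> R) : Prop :=
  smooth_inside c /\ end_values (derive1n 2 (c \+ o)) 0 0.

(* Same problem with the end conditions put on [c] instead of [c + o]: its
   second derivative vanishes at t_0^+ and "at t_n^+", i.e. it equals the jump
   of [o2] at t_n^-. *)
Definition smoothing_ends_c (c : R -> R) : Prop :=
  smooth_inside c /\ end_values (derive1n 2 c) 0 (jump o2 n).

(* Compensations live on [t 0, t n[; their values elsewhere are immaterial. *)
Definition uniquely_given (P : (R -> R) -> Prop) (piece : nat -> R -> R) :
    Prop :=
  exists c : R -> R,
  [/\ P c,
      forall c', P c' -> forall s, s \in `[t 0%N, t n[ -> c' s = c s &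
      forall k, (k < n)%N ->
        forall s, s \in `[t k, t k.+1[ -> c s = piece k s].

End Compensation.

(* Main.v *)
(* On each interval a cubic is determined by its values and its second
   derivatives at both ends.  Constraint (1) prescribes the values.  By (3) the
   second derivatives depend on one unknown per node, M_k = c_k''(t_k), because
   c_k''(t_{k+1}) is M_{k+1} plus the jump at t_{k+1} of the second derivative
   of the output.  Constraint (2) at t_k is then row k of a tridiagonal system
   whose matrix is invertible by strict diagonal dominance, as mu_k + lambda_k =
   1 < 2.  The end conditions prescribe M_0 and M_n.  The chain rule along the
   flow provides the derivatives of the output inside the intervals, and
   continuity of these as functions of the state provides their limits at the
   nodes. *)

Require Import Defs.
From HB Require Import structures.
From mathcomp Require Import all_boot all_order all_algebra.
From mathcomp Require Import all_classical all_reals all_analysis.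
From mathcomp Require Import ring lra zify.

Set Implicit Arguments.
Unset Strict Implicit.
Unset Printing Implicit Defensive.

Import Order.TTheory GRing.Theory Num.Theory.
Import numFieldNormedType.Exports.

Local Open Scope classical_set_scope.
Local Open Scope ring_scope.

Lemma continuous_funM {R : realType} {T : topologicalType} (F G : T -> R) :
  continuous F -> continuous G -> continuous (fun x => F x * G x).
Proof. by move=> cF cG x; apply: cvgM; [exact: cF|exact: cG]. Qed.

Lemma continuous_fun_addM {R : realType} {T : topologicalType}
    (F G F1 G1 : T -> R) :
  continuous F -> continuous G -> continuous F1 -> continuous G1 ->
  continuous (fun x => F x * G x + F1 x * G1 x).
Proof.
by move=> cF cG cF1 cG1 x; apply: cvgD; exact: continuous_funM.
Qed.

(** * Derivatives of the output along the flow *)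

Section FlowCalculus.
Context {R : realType} {m : nat}.
Implicit Types (f : 'cV[R]_m -> 'cV[R]_m) (g : 'cV[R]_m -> R).

Lemma derive_partial {V : normedModType R} (F : 'cV[R]_m -> V) x v :
  differentiable F x -> 'D_v F x = \sum_i v i ord0 *: partial F i x.
Proof.
move=> dF; rewrite deriveE// [in LHS](matrix_sum_delta v) linear_sum/=.
apply: eq_bigr => i _; rewrite big_ord1 linearZ /partial deriveE//.
Qed.

(** Chain rule with the velocity as direction: for [v = f (h s)] a time derivative along the flow
    becomes a directional derivative in state space. *)
Lemma is_derive_comp_path (F : 'cV[R]_m -> R) (h : R -> 'cV[R]_m) s v :
  differentiable F (h s) -> is_derive s 1 h v ->
  is_derive s (1 : R) (F \o h) ('D_v F (h s)).
Proof.
move=> dF [/derivable1_diffP dh hv].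
have dFh : differentiable (F \o h) s by exact: differentiable_comp.
split; first exact/derivable1_diffP.
by rewrite -hv deriveE// diff_comp//= !deriveE.
Qed.

Lemma output_d1E f g x :
  output_d1 f g x = \sum_i partial g i x * f x i ord0.
Proof. by rewrite /output_d1 !mxE; apply: eq_bigr => i _; rewrite !mxE. Qed.

Lemma output_d2E f g x : output_d2 f g x =
  \sum_i ((\sum_j f x j ord0 * partial (partial g i) j x) * f x i ord0
          + partial g i x * (\sum_j partial f j x i ord0 * f x j ord0)).
Proof.
rewrite /output_d2 -(mulmxA (gradient g x)^T) mxE mxE [X in _ + X]mxE.
rewrite big_split/=; congr (_ + _); apply: eq_bigr => i _; rewrite !mxE;
  congr (_ * _); apply: eq_bigr => j _; rewrite !mxE//.
Qed.

Lemma derive_output g f x : differentiable g x ->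
  'D_(f x) g x = output_d1 f g x.
Proof.
move=> dg; rewrite derive_partial// output_d1E.
by apply: eq_bigr => i _; rewrite mulrC.
Qed.

Lemma differentiable_coord_comp f i x :
  differentiable f x -> differentiable (fun y => f y i ord0) x.
Proof.
move=> df; apply: (@differentiable_comp _ _ _ _ f (fun M => M i ord0)) => //.
exact: differentiable_coord.
Qed.

Lemma derive_coord f i x v : differentiable f x ->
  'D_v (fun y => f y i ord0) x = ('D_v f x) i ord0.
Proof.
move=> df; rewrite derive_mx ?mxE//.
exact: diff_derivable.
Qed.

Lemma output_d1_sum f g :
  output_d1 f g = \sum_i (partial g i * (fun y => f y i ord0)).
Proof. by apply/funext => x; rewrite output_d1E fct_sumE. Qed.

Lemma differentiable_output_d1 f g x : is_C1 f -> is_C2 g ->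
  differentiable (output_d1 f g) x.
Proof.
move=> [df _] [_ dg]; rewrite output_d1_sum; apply: differentiable_sum => i.
by apply: differentiableM; [exact: (dg i).1|exact: differentiable_coord_comp].
Qed.

(** Product rule on each summand of [output_d1_sum]: differentiating [partial g i] yields the
    Hessian term, differentiating a coordinate of [f] the Jacobian term. *)
Lemma derive_output_d1 f g x : is_C1 f -> is_C2 g ->
  'D_(f x) (output_d1 f g) x = output_d2 f g x.
Proof.
move=> [df _] [_ dg]; rewrite output_d1_sum derive_sum; last first.
  move=> i; apply: diff_derivable; apply: differentiableM.
    exact: (dg i).1.
  exact: differentiable_coord_comp.
rewrite output_d2E; apply: eq_bigr => i _.
rewrite deriveM; last 2 first.
  by apply: diff_derivable; exact: (dg i).1.
  by apply: diff_derivable; exact: differentiable_coord_comp.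
rewrite derive_coord// !derive_partial//; last exact: (dg i).1.
rewrite addrC summxE; congr (_ + _); rewrite /GRing.scale/=.
  by rewrite mulrC.
by congr (_ * _); apply: eq_bigr => j _; rewrite mxE mulrC.
Qed.

(** The continuity of the second partials of [g] and of the partials of [f] enters here; it gives
    the second derivative of the output its one-sided limits at the nodes. *)
Lemma continuous_output_d2 f g : is_C1 f -> is_C2 g ->
  continuous (output_d2 f g).
Proof.
move=> [df cf] [[_ cg] dg].
have cfi i : continuous (fun y => f y i ord0).
  by move=> y; exact/differentiable_continuous/differentiable_coord_comp.
have -> : output_d2 f g = fun x => \sum_i
   ((\sum_j f x j ord0 * partial (partial g i) j x) * f x i ord0
          + partial g i x * (\sum_j partial f j x i ord0 * f x j ord0)).
  by apply/funext => y; rewrite output_d2E.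
apply: (continuous_big add_continuous) => i _.
apply: continuous_fun_addM.
- apply: (continuous_big add_continuous) => j _.
  by apply: continuous_funM; [exact: cfi|exact: (dg i).2].
- exact: cfi.
- exact: cg.
- apply: (continuous_big add_continuous) => j _.
  apply: continuous_funM; last exact: cfi.
  move=> x; apply: (@continuous_comp _ _ _ (partial f j)
    (fun M : 'cV[R]_m => M i ord0)); first exact: cf.
  exact: coord_continuous.
Qed.

End FlowCalculus.

(** * Limits at the nodes *)

Section OneSidedLimits.
Context {R : realType}.
Implicit Types (F u : R -> R) (Q : {poly R}).

Lemma derive1_horner_add F u (u' : R -> R) Q (a b : R) :
  (forall s, s \in `]a, b[ -> F s = Q.[s] + u s) ->
  (forall s, s \in `]a, b[ -> is_derive s (1 : R) u (u' s)) ->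
  forall s, s \in `]a, b[ -> derive1 F s = Q^`().[s] + u' s.
Proof.
move=> FQ du s sab; rewrite derive1E.
have ds := du s sab.
rewrite (near_eq_derive (g := horner Q + u)); last first.
  by near=> z; apply: FQ; near: z; exact: near_in_itvoo.
rewrite derive_val//.
Unshelve. all: by end_near. Qed.

Lemma cvg_at_right_horner_add F u Q (a b l : R) : a < b ->
  (forall s, s \in `]a, b[ -> F s = Q.[s] + u s) ->
  u s @[s --> a^'+] --> l -> F s @[s --> a^'+] --> Q.[a] + l.
Proof.
move=> ab FQ ul; apply: cvg_trans.
  apply: (near_eq_cvg (f := fun s => Q.[s] + u s)).
  near=> s; rewrite FQ// in_itv/=; apply/andP; split; near: s.
    exact: nbhs_right_gt.
  exact: nbhs_right_lt.
by apply: cvgD => //; apply: cvg_at_right_filter; exact: continuous_horner.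
Unshelve. all: by end_near. Qed.

Lemma cvg_at_left_horner_add F u Q (a b l : R) : a < b ->
  (forall s, s \in `]a, b[ -> F s = Q.[s] + u s) ->
  u s @[s --> b^'-] --> l -> F s @[s --> b^'-] --> Q.[b] + l.
Proof.
move=> ab FQ ul; apply: cvg_trans.
  apply: (near_eq_cvg (f := fun s => Q.[s] + u s)).
  near=> s; rewrite FQ// in_itv/=; apply/andP; split; near: s.
    exact: nbhs_left_gt.
  exact: nbhs_left_lt.
by apply: cvgD => //; apply: cvg_at_left_filter; exact: continuous_horner.
Unshelve. all: by end_near. Qed.

End OneSidedLimits.

Section NodalConditions.
Context {R : realType} {n : nat} {t : nat -> R}.
Hypothesis t_incr : forall k, (k < n)%N -> t k < t k.+1.

(** Right-continuity lets [F (t k)] stand for the right limit. As [left_lim] is defined by [lim],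
    the second clause asserts that the left limit exists. *)
Definition has_node_limits (F : R -> R) : Prop := forall k, (k < n)%N ->
  F s @[s --> (t k)^'+] --> F (t k) /\
  F s @[s --> (t k.+1)^'-] --> left_lim F (t k.+1).

(** This shape is stable under differentiation: [c + o] and its two derivatives have it with [u]
    equal to [o], [o1], [o2]. Open intervals are used because derivatives are not controlled at the
    nodes. *)
Definition piecewise_poly (F : R -> R) (P : nat -> {poly R}) (u : R -> R) :=
  forall k, (k < n)%N ->
  forall s, s \in `]t k, t k.+1[ -> F s = (P k).[s] + u s.

Lemma piecewise_derive1 F P u u' :
  piecewise_poly F P u ->
  (forall k s, (k < n)%N -> s \in `]t k, t k.+1[ ->
     is_derive s (1 : R) u (u' s)) ->
  piecewise_poly (derive1 F) (fun k => (P k)^`()) u'.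
Proof.
move=> FP du k kn; apply: derive1_horner_add; first exact: FP.
by move=> s; exact: du.
Qed.

Lemma piecewise_cvg_right F P u k : piecewise_poly F P u ->
  has_node_limits u -> (k < n)%N ->
  F s @[s --> (t k)^'+] --> (P k).[t k] + u (t k).
Proof.
move=> FP uE kn; apply: (cvg_at_right_horner_add (t_incr kn) (FP k kn)).
exact: (uE k kn).1.
Qed.

Lemma piecewise_cvg_left F P u k : piecewise_poly F P u ->
  has_node_limits u -> (k < n)%N ->
  F s @[s --> (t k.+1)^'-] --> (P k).[t k.+1] + left_lim u (t k.+1).
Proof.
move=> FP uE kn; apply: (cvg_at_left_horner_add (t_incr kn) (FP k kn)).
exact: (uE k kn).2.
Qed.

(** By uniqueness of limits, agreement at a node equates [P k] plus the left limit of [u] with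
    [P k.+1] plus the right one; the gap between the polynomials absorbs the jump. *)
Lemma matches_at_nodesP F P u : piecewise_poly F P u -> has_node_limits u ->
  matches_at_nodes n t F <->
  forall k, (k.+1 < n)%N ->
    (P k).[t k.+1] - (P k.+1).[t k.+1] = jump t u k.+1.
Proof.
move=> FP uE; split=> [Fm k kn|Pm [//|k] /= kn].
  have [l [Fl Fr]] := Fm k.+1 kn.
  have El : l = (P k).[t k.+1] + left_lim u (t k.+1).
    exact: cvg_unique Fl (piecewise_cvg_left FP uE (ltnW kn)).
  have Er : l = (P k.+1).[t k.+1] + u (t k.+1).
    exact: cvg_unique Fr (piecewise_cvg_right FP uE kn).
  by rewrite /jump; lra.
have Fl := piecewise_cvg_left FP uE (ltnW kn).
have Fr := piecewise_cvg_right FP uE kn.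
exists ((P k.+1).[t k.+1] + u (t k.+1)); split=> //.
have := Pm k kn; rewrite /jump => Pk.
by rewrite (_ : _ + _ = (P k).[t k.+1] + left_lim u (t k.+1)) //; lra.
Qed.

Lemma end_valuesP F P u v w : (0 < n)%N -> piecewise_poly F P u ->
  has_node_limits u ->
  end_values n t F v w <->
  (P 0%N).[t 0%N] + u (t 0%N) = v /\
  (P n.-1).[t n] + left_lim u (t n) = w.
Proof.
move=> n0 FP uE.
have Fr := piecewise_cvg_right FP uE n0.
have n1 : (n.-1 < n)%N by rewrite prednK.
have := piecewise_cvg_left FP uE n1; rewrite prednK// => Fl.
split=> [[Fv Fw]|[<- <-]//].
by split; [exact: cvg_unique Fr Fv|exact: cvg_unique Fl Fw].
Qed.

(** Constraint (1) decouples the pieces: each gets its own value at each end, whatever its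
    neighbours are. *)
Lemma interpolatesP x c P o : (0 < n)%N ->
  (forall k, (k < n)%N ->
    forall s, s \in `[t k, t k.+1[ -> c s = (P k).[s]) ->
  has_node_limits o ->
  interpolates n t x (c \+ o) <->
  forall k, (k < n)%N -> (P k).[t k] = eps_plus t x o k /\
    (P k).[t k.+1] = eps_minus t x o k.+1.
Proof.
move=> n0 cP oE.
have FP : piecewise_poly (c \+ o) P o.
  by move=> k kn s sk; rewrite /= (cP k)//; exact: subset_itv_oo_co sk.
rewrite /eps_plus /eps_minus.
have c0 : c (t 0%N) = (P 0%N).[t 0%N].
  by rewrite (cP 0%N)// in_itv/= lexx t_incr.
split=> [[xi x0 xn] k kn|PE].
  split.
    case: k kn => [_|k kn]; first by rewrite -c0 -x0 addrK.
    suff -> : x k.+1 = (P k.+1).[t k.+1] + o (t k.+1) by rewrite addrK.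
    exact: cvg_unique (xi k.+1 kn).2 (piecewise_cvg_right FP oE kn).
  have Fl := piecewise_cvg_left FP oE kn.
  suff -> : x k.+1 = (P k).[t k.+1] + left_lim o (t k.+1) by rewrite addrK.
  (* The right end of a piece is either an interior node or [t n], where the constraint is the
     separate left limit. *)
  have [kn1|kn1] := ltnP k.+1 n; first exact: cvg_unique (xi k.+1 kn1).1 Fl.
  have kE : n = k.+1 by apply/eqP; rewrite eqn_leq kn kn1.
  by rewrite kE in xn; exact: cvg_unique xn Fl.
split=> [[//|k] /= kn||].
- split.
    have := piecewise_cvg_left FP oE (ltnW kn).
    by rewrite (PE k (ltnW kn)).2 subrK.
  by have := piecewise_cvg_right FP oE kn; rewrite (PE _ kn).1 subrK.
- by rewrite /= c0 (PE _ n0).1 subrK.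
- have n1 : (n.-1 < n)%N by rewrite prednK.
  by have := piecewise_cvg_left FP oE n1; rewrite (PE _ n1).2 prednK// subrK.
Qed.

End NodalConditions.

(** * Cubics given by values and second derivatives at two points *)

Section CubicPieces.
Context {R : realType}.
Implicit Types (P : {poly R}) (a b ya yb ma mb s : R).

(** The second derivative is the affine interpolant of [ma] and [mb]; the linear coefficient is then
    tuned to reach [yb] at [b]. *)
Definition cubic a b ya yb ma mb : {poly R} :=
  ((mb - ma) / (6 * (b - a))) *: ('X - a%:P) ^+ 3
  + (ma / 2) *: ('X - a%:P) ^+ 2
  + ((yb - ya) / (b - a) - (b - a) * (mb + 2 * ma) / 6) *: ('X - a%:P)
  + ya%:P.

Lemma size_cubic a b ya yb ma mb : (size (cubic a b ya yb ma mb) <= 4)%N.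
Proof.
have sz c k : (k <= 3)%N -> (size (c *: ('X - a%:P) ^+ k) <= 4)%N.
  move=> k3; apply: leq_trans (size_scale_leq _ _) _.
  by rewrite size_exp_XsubC.
have szD (p q : {poly R}) :
    (size p <= 4)%N -> (size q <= 4)%N -> (size (p + q)%R <= 4)%N.
  by move=> p4 q4; rewrite (leq_trans (size_polyD _ _))// geq_max p4.
apply: (szD _ _ _); last by rewrite (leq_trans (size_polyC_leq1 _)).
by apply: (szD _ _ _); [apply: szD; exact: sz|exact: (sz _ 1)].
Qed.

Lemma horner_cubic a b ya yb ma mb s :
  (cubic a b ya yb ma mb).[s] =
  (mb - ma) / (6 * (b - a)) * (s - a) ^+ 3 + ma / 2 * (s - a) ^+ 2
  + ((yb - ya) / (b - a) - (b - a) * (mb + 2 * ma) / 6) * (s - a) + ya.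
Proof. by rewrite /cubic !hornerE. Qed.

Lemma deriv_cubic a b ya yb ma mb s :
  (cubic a b ya yb ma mb)^`().[s] =
  (mb - ma) / (6 * (b - a)) * (3 * (s - a) ^+ 2) + ma * (s - a)
  + ((yb - ya) / (b - a) - (b - a) * (mb + 2 * ma) / 6).
Proof.
(* The inverse of [b - a] is kept as an atom, so that [field] asks for no side condition on it. *)
rewrite /cubic !poly.derivE/= !hornerE/= !invfM.
by set u := (b - a)^-1; field.
Qed.

Lemma deriv2_cubic a b ya yb ma mb s :
  (cubic a b ya yb ma mb)^`()^`().[s] =
  (mb - ma) / (b - a) * (s - a) + ma.
Proof.
rewrite /cubic !poly.derivE/= !hornerE/= !invfM.
by set u := (b - a)^-1; field.
Qed.

Lemma horner_size4 P s : (size P <= 4)%N ->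
  [/\ P.[s] = P`_0 + P`_1 * s + P`_2 * s ^+ 2 + P`_3 * s ^+ 3 &
      P^`()^`().[s] = 2 * P`_2 + 6 * P`_3 * s].
Proof.
move=> sP; split.
  by rewrite (horner_coef_wide _ sP) !big_ord_recr big_ord0/= expr0 expr1; ring.
have sP1 : (size P^`() <= 3)%N.
  by apply: leq_trans (size_poly _ _) _; case: (size P) sP.
have sP2 : (size P^`()^`() <= 2)%N.
  by apply: leq_trans (size_poly _ _) _; case: (size P^`()) sP1.
rewrite (horner_coef_wide _ sP2) !big_ord_recr big_ord0/= !coef_deriv.
by rewrite expr0 expr1; ring.
Qed.

(** Written in the four coefficients of [P], both sides agree identically once [b - a] is nonzero.
    Uniqueness of the compensation rests on this. *)
Lemma cubic_interpolation P a b s : a < b -> (size P <= 4)%N ->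
  P.[s] = (cubic a b P.[a] P.[b] P^`()^`().[a] P^`()^`().[b]).[s].
Proof.
move=> ab sP; rewrite horner_cubic.
have [-> _] := horner_size4 s sP.
have [-> ->] := horner_size4 a sP; have [-> ->] := horner_size4 b sP.
by field; rewrite subr_eq0 gt_eqF.
Qed.

End CubicPieces.

(** * The tridiagonal system *)

Section TridiagonalSystem.
Context {R : realType} (n : nat) (t : nat -> R).
Hypothesis t_incr : forall k, (k < n)%N -> t k < t k.+1.

(** Row [k] of the system extended by columns for [M 0] and [M n]; [Amx] has only the columns 1 to n
    - 1, and [end_terms] holds the rest. *)
Definition row_lhs (M : nat -> R) k : R :=
  mu t k * M k.-1 + 2 * M k + lambda t k * M k.+1.

Lemma tau_gt0 k : (k < n)%N -> 0 < tau t k.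
Proof. by move=> kn; rewrite subr_gt0 t_incr. Qed.

Lemma mu_lambda k : (0 < k < n)%N ->
  [/\ 0 <= mu t k, 0 <= lambda t k & mu t k + lambda t k = 1].
Proof.
case: k => [//|k] /= kn.
have tk := tau_gt0 kn; have tk1 := tau_gt0 (ltnW kn).
rewrite /mu /lambda /=; split.
- by apply: divr_ge0; [|apply: addr_ge0]; exact: ltW.
- by apply: divr_ge0; [|apply: addr_ge0]; exact: ltW.
- by rewrite -mulrDl divff// gt_eqF// addr_gt0.
Qed.

(** Extracts one diagonal of a banded matrix product; the test [k < N] discards an entry falling
    outside the matrix. *)
Lemma sum_pick N (c : R) (F : nat -> R) k :
  \sum_(j < N) (if j == k :> nat then c else 0) * F j
  = if (k < N)%N then c * F k else 0.
Proof.
case: ifPn => kN.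
  rewrite (bigD1 (Ordinal kN))//= eqxx big1 ?addr0// => j jk.
  by rewrite ifN ?mul0r//; apply: contra jk => /eqP jk; exact/eqP/val_inj.
rewrite big1// => j _; rewrite ifN ?mul0r//.
by apply: contra kN => /eqP <-.
Qed.

Lemma Amx_mul (M : nat -> R) (i : 'I_n.-1) :
  (Amx n t *m \col_(j < n.-1) M j.+1) i ord0
  = row_lhs M i.+1 - end_terms n t (M 0%N) (M n) i ord0.
Proof.
have i_lt : (i.+1 < n)%N by have := ltn_ord i; lia.
rewrite !mxE.
(* The three tests defining an entry exclude one another, so the nested conditional is a sum of
   three diagonals. *)
transitivity (\sum_(j < n.-1)
  ((if j == i :> nat then 2 else 0) * M j.+1
   + ((if j == i.+1 :> nat then lambda t i.+1 else 0) * M j.+1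
   + (if i == j.+1 :> nat then mu t i.+1 else 0) * M j.+1))).
  apply: eq_bigr => j _; rewrite !mxE -!mulrDl; congr (_ * _).
  have [->|ji] := eqVneq (j : nat) i.
    by rewrite (ltn_eqF (ltnSn i)) !addr0.
  have [->|ji1] := eqVneq (j : nat) i.+1.
    by rewrite (@ltn_eqF i) ?addr0 ?add0r//; lia.
  by rewrite !add0r.
rewrite !big_split/= (sum_pick _ _ (fun j => M j.+1)) ltn_ord.
rewrite (sum_pick _ _ (fun j => M j.+1)).
have -> : \sum_(j < n.-1) (if i == j.+1 :> nat then mu t i.+1 else 0) * M j.+1
    = if i == 0%N :> nat then 0 else mu t i.+1 * M i.
  case: i i_lt => [[|i] /= ii] _.
    by rewrite big1// => j _; rewrite mul0r.
  under eq_bigr do rewrite eqSS eq_sym.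
  by rewrite (sum_pick _ _ (fun j => M j.+1)) (ltnW ii).
rewrite /row_lhs/=.
have -> : (i.+1 < n.-1)%N = (i.+2 != n) by lia.
have [i0|i0] := eqVneq (i : nat) 0%N; have [i2|i2] := eqVneq i.+2 n => /=.
(* [n] occurs in the type of [i], so it is replaced only under [M] and [lambda]. *)
- rewrite (congr1 M (esym i2)) (congr1 (lambda t) (congr1 predn (esym i2))).
  by rewrite i0/=; ring.
- by rewrite i0/=; ring.
- rewrite (congr1 M (esym i2)) (congr1 (lambda t) (congr1 predn (esym i2)))/=.
  by ring.
- by ring.
Qed.

(** For a kernel vector, the row of an entry [v_i] of largest absolute value gives
    [2 |v_i| <= (mu + lambda) |v_i| = |v_i|], so the vector is zero. *)
Lemma Amx_unit : Amx n t \in unitmx.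
Proof.
rewrite -unitmx_tr -row_free_unit; apply: inj_row_free => v vA.
apply/rowP => j0; rewrite mxE.
(* Extending the vector by 0 at index 0 and from [n] on makes the end terms vanish, and all rows
   take the same three-term form. *)
pose M k :=
  if k is k'.+1 then oapp (v ord0) 0 (insub k' : option 'I_n.-1) else 0.
have Mv : \col_(j < n.-1) M j.+1 = v^T.
  by apply/colP => j; rewrite !mxE /M valK.
have M0 : M 0%N = 0 by [].
have Mge k : (n <= k)%N -> M k = 0.
  by case: k => [//|k] nk; rewrite /M insubN//; lia.
have Mn : M n = 0 by exact: Mge.
have AM : Amx n t *m \col_(j < n.-1) M j.+1 = 0.
  by rewrite Mv -[Amx n t]trmxK -trmx_mul vA trmx0.
pose i := [arg max_(i > j0) `|v ord0 i|]%O.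
have vi j : `|v ord0 j| <= `|v ord0 i|.
  by rewrite /i; case: arg_maxP => // k _; exact.
have Mi k : `|M k| <= `|v ord0 i|.
  case: k => [|k]; first by rewrite normr0.
  by rewrite /M; case: insubP => [j _ _|_] /=; rewrite ?normr0.
have MiE : M i.+1 = v ord0 i by rewrite /M valK.
clearbody M; have := Amx_mul M i.
rewrite AM M0 Mn !mxE !mulr0 !if_same addr0 subr0 /row_lhs.
have i_lt : (0 < i.+1 < n)%N by have := ltn_ord i; lia.
have [mu0 la0 mula] := mu_lambda i_lt.
rewrite MiE /= => row0.
(* [normrM] would unfold [mu] and [lambda]. *)
move: (mu t _) (lambda t _) mu0 la0 mula row0 => u l u0 l0 ul row0.
have : `|2 * v ord0 i| <= `|v ord0 i|.
  have -> : 2 * v ord0 i = - (u * M i + l * M i.+2) by lra.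
  rewrite normrN (le_trans (ler_normD _ _))// !normrM.
  rewrite (ger0_norm u0) (ger0_norm l0).
  rewrite -[leRHS]mul1r -ul mulrDl lerD// ler_wpM2l//.
rewrite normrM ger0_norm// => vi2.
by apply/eqP; rewrite -normr_le0 (le_trans (vi j0))//; lra.
Qed.

(** Passes between the inverse-matrix formula and one scalar equation per interior node; the end
    terms cancel those of [Amx_mul]. *)
Lemma Amx_system (M : nat -> R) (d : nat -> R) :
  \col_(i < n.-1) M i.+1 =
    invmx (Amx n t) *m (\col_(i < n.-1) d i.+1 - end_terms n t (M 0%N) (M n))
  <-> forall k, (k.+1 < n)%N -> row_lhs M k.+1 = d k.+1.
Proof.
split=> [ME k kn|Mrow].
  have kn1 : (k < n.-1)%N by lia.
  have := Amx_mul M (Ordinal kn1).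
  by rewrite ME mulKVmx ?Amx_unit// !mxE/= => /addIr.
rewrite -[LHS](mulKmx Amx_unit); congr (_ *m _).
apply/colP => i; rewrite Amx_mul [in RHS]mxE [X in _ = X + _]mxE Mrow ?mxE//.
by have := ltn_ord i; lia.
Qed.

End TridiagonalSystem.

(** * Existence and uniqueness of the compensation *)

Section Splines.
Context {R : realType} {n : nat} {t : nat -> R} (x : nat -> R).
Context {o o1 o2 : R -> R}.
Hypothesis n_gt0 : (0 < n)%N.
Hypothesis t_incr : forall k, (k < n)%N -> t k < t k.+1.
Hypothesis o_deriv : forall k s, (k < n)%N -> s \in `]t k, t k.+1[ ->
  is_derive s (1 : R) o (o1 s).
Hypothesis o1_deriv : forall k s, (k < n)%N -> s \in `]t k, t k.+1[ ->
  is_derive s (1 : R) o1 (o2 s).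
Hypothesis o_lim : has_node_limits (n := n) (t := t) o.
Hypothesis o1_lim : has_node_limits (n := n) (t := t) o1.
Hypothesis o2_lim : has_node_limits (n := n) (t := t) o2.

Lemma node_le i j : (i <= j <= n)%N -> t i <= t j.
Proof.
elim: j => [|j IHj]; first by rewrite leqn0 => /andP[/eqP ->].
rewrite leq_eqVlt ltnS andb_orl => /orP[/andP[/eqP -> //]|/andP[ij jn]].
by apply: le_trans (IHj _) (ltW (t_incr jn)); rewrite ij ltnW.
Qed.

Lemma node_cover s : s \in `[t 0%N, t n[ ->
  exists2 k, (k < n)%N & s \in `[t k, t k.+1[.
Proof.
rewrite in_itv/= => /andP[s0 sn].
suff: forall j, s < t j -> (j <= n)%N ->
    exists2 k, (k < n)%N & s \in `[t k, t k.+1[.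
  by move/(_ n sn (leqnn n)).
elim=> [|j IHj] sj jn; first by rewrite leNgt sj in s0.
have [/IHj|tjs] := ltP s (t j); first by apply; exact: ltnW.
by exists j => //; rewrite in_itv/= tjs.
Qed.

Lemma node_interval_inj s j k : (j < n)%N -> (k < n)%N ->
  s \in `[t j, t j.+1[ -> s \in `[t k, t k.+1[ -> j = k.
Proof.
rewrite !in_itv/= => jn kn /andP[js sj] /andP[ks sk].
have [jk|kj|//] := ltngtP j k.
  have jk1 : t j.+1 <= t k by apply: node_le; rewrite jk ltnW.
  by have := lt_le_trans sj (le_trans jk1 ks); rewrite ltxx.
have kj1 : t k.+1 <= t j by apply: node_le; rewrite kj ltnW.
by have := lt_le_trans sk (le_trans kj1 js); rewrite ltxx.
Qed.

(** The half-open intervals are disjoint, so the index picked at [s] is the only candidate; outside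
    all of them the value is set to 0. *)
Lemma glue_pieces (piece : nat -> R -> R) : exists c : R -> R,
  forall k, (k < n)%N -> forall s, s \in `[t k, t k.+1[ -> c s = piece k s.
Proof.
exists (fun s => if [pick k : 'I_n | s \in `[t k, t k.+1[] is Some k
  then piece k s else 0) => k kn s sk.
case: pickP => [j sj|/(_ (Ordinal kn))]; last by rewrite sk.
by rewrite (node_interval_inj (ltn_ord j) kn sj sk).
Qed.

(** The left ends are included, since constraint (1) at [t 0] concerns the value there. *)
Definition has_pieces (c : R -> R) (P : nat -> {poly R}) := forall k,
  (k < n)%N -> forall s, s \in `[t k, t k.+1[ -> c s = (P k).[s].

Lemma smooth_insideP c (P : nat -> {poly R}) :
  (forall k, (k < n)%N -> (size (P k) <= 4)%N) ->
  has_pieces c P -> smooth_inside n t x o c <->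
  [/\ forall k, (k < n)%N -> (P k).[t k] = eps_plus t x o k /\
        (P k).[t k.+1] = eps_minus t x o k.+1,
      forall k, (k.+1 < n)%N ->
        (P k)^`().[t k.+1] - (P k.+1)^`().[t k.+1] = jump t o1 k.+1 &
      forall k, (k.+1 < n)%N ->
        (P k)^`()^`().[t k.+1] - (P k.+1)^`()^`().[t k.+1] = jump t o2 k.+1].
Proof.
move=> sP cP.
have yP : piecewise_poly (n := n) (t := t) (c \+ o) P o.
  by move=> k kn s sk; rewrite /= (cP k)//; exact: subset_itv_oo_co sk.
have y1P := piecewise_derive1 yP o_deriv.
have y2P := piecewise_derive1 y1P o1_deriv.
have iE := interpolatesP t_incr x n_gt0 cP o_lim.
have d1E := matches_at_nodesP t_incr y1P o1_lim.
have d2E := matches_at_nodesP t_incr y2P o2_lim.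
split=> [[_ /iE ? /d1E ? /d2E ?]//|[/iE ? /d1E ? /d2E ?]].
by split=> // k kn; exists (P k); [exact: sP|exact: cP].
Qed.

Lemma end_values_outputP c P v w : has_pieces c P ->
  end_values n t (derive1n 2 (c \+ o)) v w <->
  (P 0%N)^`()^`().[t 0%N] + o2 (t 0%N) = v /\
  (P n.-1)^`()^`().[t n] + left_lim o2 (t n) = w.
Proof.
move=> cP.
have yP : piecewise_poly (n := n) (t := t) (c \+ o) P o.
  by move=> k kn s sk; rewrite /= (cP k)//; exact: subset_itv_oo_co sk.
have y1P := piecewise_derive1 yP o_deriv.
have y2P := piecewise_derive1 y1P o1_deriv.
exact: (end_valuesP t_incr _ _ n_gt0 y2P o2_lim).
Qed.

Lemma end_values_pieceP c P v w : has_pieces c P ->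
  end_values n t (derive1n 2 c) v w <->
  (P 0%N)^`()^`().[t 0%N] = v /\ (P n.-1)^`()^`().[t n] = w.
Proof.
move=> cP.
(* The compensation alone is handled as piecewise polynomial plus the zero function. *)
have d0 k s : (k < n)%N -> s \in `]t k, t k.+1[ ->
    is_derive s (1 : R) (cst 0 : R -> R) (cst 0 s : R).
  by move=> _ _; exact: is_derive_cst.
have yP : piecewise_poly (n := n) (t := t) c P (cst 0).
  by move=> k kn s sk; rewrite /= addr0 (cP k)//; exact: subset_itv_oo_co sk.
have y2P := piecewise_derive1 (piecewise_derive1 yP d0) d0.
have l0 s : left_lim (cst 0 : R -> R) s = 0.
  by apply: cvg_lim => //; exact: cvg_cst.
have lim0 : has_node_limits (n := n) (t := t) (cst 0).
  by move=> k _; rewrite l0; split; exact: cvg_cst.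
have := end_valuesP t_incr v w n_gt0 y2P lim0.
by rewrite l0 /= !addr0.
Qed.

Definition spline_poly (M : nat -> R) k : {poly R} :=
  cubic (t k) (t k.+1) (eps_plus t x o k) (eps_minus t x o k.+1)
    (M k) (M k.+1 + jump t o2 k.+1).

Lemma horner_spline_poly M k s :
  (spline_poly M k).[s] = cubic_piece t x o o2 M k s.
Proof. by rewrite horner_cubic. Qed.

Lemma spline_poly_left M k : (spline_poly M k).[t k] = eps_plus t x o k.
Proof. by rewrite horner_cubic subrr; ring. Qed.

Lemma spline_poly_right M k : (k < n)%N ->
  (spline_poly M k).[t k.+1] = eps_minus t x o k.+1.
Proof.
move=> kn; rewrite horner_cubic; field.
by rewrite subr_eq0 gt_eqF// t_incr.
Qed.

Lemma deriv2_spline_poly_left M k : (spline_poly M k)^`()^`().[t k] = M k.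
Proof. by rewrite deriv2_cubic subrr mulr0 add0r. Qed.

Lemma deriv2_spline_poly_right M k : (k < n)%N ->
  (spline_poly M k)^`()^`().[t k.+1] = M k.+1 + jump t o2 k.+1.
Proof.
by move=> kn; rewrite deriv2_cubic divfK ?subrK// subr_eq0 gt_eqF// t_incr.
Qed.

Lemma deriv_spline_poly_jump M k : (k.+1 < n)%N ->
  (spline_poly M k)^`().[t k.+1] - (spline_poly M k.+1)^`().[t k.+1]
    = jump t o1 k.+1
  <-> row_lhs t M k.+1 = dcoef t x o o1 o2 k.+1.
Proof.
move=> kn; rewrite !deriv_cubic subrr.
rewrite /row_lhs /dcoef /eps_slope /mu /lambda /tau /=.
have h0 := t_incr (ltnW kn); have h1 := t_incr kn.
rewrite -!/(tau t k) -!/(tau t k.+1).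
have : 0 < tau t k by rewrite subr_gt0.
have : 0 < tau t k.+1 by rewrite subr_gt0.
move: (tau t k) (tau t k.+1) (jump t o1 k.+1) (jump t o2 k.+1) (jump t o2 k.+2).
move: (eps_plus t x o k) (eps_plus t x o k.+1).
move: (eps_minus t x o k.+1) (eps_minus t x o k.+2).
move: (M k) (M k.+1) (M k.+2).
move=> m0 m1 m2 e1 e2 p0 p1 u v r1 q1 q2 v0 u0.
have un0 : u != 0 by rewrite gt_eqF.
have vn0 : v != 0 by rewrite gt_eqF.
have uvn0 : u + v != 0 by rewrite gt_eqF// addr_gt0.
set L := (X in X = r1 <-> _); set A := (X in _ <-> X = _).
set B := (X in _ <-> _ = X).
(* [u] and [v] are the lengths of the intervals on either side of the node. The factor [6 / (u + v)]
   scales the coefficient [(u + v) / 3] of the middle unknown in [L] to the diagonal entry 2. *)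
have E : A - B = 6 / (u + v) * (L - r1).
  by rewrite /A /B /L; field; rewrite un0 vn0 uvn0.
have c0 : 6 / (u + v) != 0 by rewrite mulf_neq0 ?invr_eq0.
split=> [Lr|AB]; apply/eqP; rewrite -subr_eq0.
  by rewrite E Lr subrr mulr0.
by rewrite -(mulrI_eq0 _ (mulfI c0)) -E AB subrr.
Qed.

(** [E] is an abstract end condition, known only to prescribe the second derivatives of the end
    pieces. This covers conditions on [c + o] and on [c] at once. *)
Lemma uniquely_given_spline (M : nat -> R) (E : (R -> R) -> Prop) :
  (forall c P, has_pieces c P -> E c <->
    (P 0%N)^`()^`().[t 0%N] = M 0%N /\
    (P n.-1)^`()^`().[t n] = M n + jump t o2 n) ->
  \col_(i < n.-1) M i.+1 = invmx (Amx n t) *m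
    (dvec n t x o o1 o2 - end_terms n t (M 0%N) (M n)) ->
  uniquely_given n t (fun c => smooth_inside n t x o c /\ E c)
    (cubic_piece t x o o2 M).
Proof.
move=> EP ME.
have [c cM] := glue_pieces (cubic_piece t x o o2 M).
have cP : has_pieces c (spline_poly M).
  by move=> k kn s sk; rewrite horner_spline_poly (cM k).
have n1 : (n.-1 < n)%N by rewrite prednK.
exists c; split=> //.
  split.
    apply/(smooth_insideP _ cP) => [k _|]; first exact: size_cubic.
    split=> k kn.
    - by rewrite spline_poly_left spline_poly_right.
    - apply/(deriv_spline_poly_jump _ kn).
      exact: (Amx_system t_incr _ _).1 ME k kn.
    - rewrite deriv2_spline_poly_left deriv2_spline_poly_right ?(ltnW kn)//.
      by rewrite addrC addKr.
  apply/(EP _ _ cP); rewrite deriv2_spline_poly_left.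
  by have := deriv2_spline_poly_right M n1; rewrite prednK.
move=> c' [c'S c'E] s st.
have [k kn sk] := node_cover st.
rewrite (cM k)//.
have [P' sP' cP'] : exists2 P : nat -> {poly R},
    (forall k, (k < n)%N -> (size (P k) <= 4)%N) & has_pieces c' P.
  have [pc _ _ _] := c'S.
  have /choice[P PP] : forall k, exists Q : {poly R}, (k < n)%N ->
      (size Q <= 4)%N /\ forall s, s \in `[t k, t k.+1[ -> c' s = Q.[s].
    move=> j; have [jn|jn] := ltnP j n; last by exists 0.
    by have [Q sQ cQ] := pc j jn; exists Q.
  by exists P => j jn; have [] := PP j jn.
have [Pend0 Pendn] := (EP _ _ cP').1 c'E.
have [PE Pd1 Pd2] := (smooth_insideP sP' cP').1 c'S.
(* No piece starts at [t n]: [M' n] is the value prescribed by the end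
   condition. *)
pose M' j := if (j < n)%N then (P' j)^`()^`().[t j] else M j.
have M'n j : (j < n)%N -> M' j = (P' j)^`()^`().[t j] by rewrite /M' => ->.
(* Each piece of a competitor is the cubic given by its end data: (1) supplies the values, and (3)
   or the end condition the second derivative at the right end. *)
have P'E j s' : (j < n)%N -> (P' j).[s'] = (spline_poly M' j).[s'].
  move=> jn; rewrite (cubic_interpolation s' (t_incr jn) (sP' j jn)).
  rewrite (PE j jn).1 (PE j jn).2 /spline_poly M'n//.
  congr (cubic _ _ _ _ _ _).[_].
  have [jn1|jn1] := ltnP j.+1 n; first by rewrite M'n// -Pd2// addrC subrK.
  have jE : n = j.+1 by apply/eqP; rewrite eqn_leq jn jn1.
  by rewrite /M' -jE ltnn -Pendn jE.
(* Only values have been compared, so the derivatives are read as those of the evaluation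
   functions. *)
have P'dE j s' : (j < n)%N -> (P' j)^`().[s'] = (spline_poly M' j)^`().[s'].
  move=> jn; have PQ : horner (P' j) = horner (spline_poly M' j).
    by apply/funext => z; exact: P'E.
  by rewrite !derive.derivE PQ.
have M'0 : M' 0%N = M 0%N by rewrite M'n// Pend0.
have M'N : M' n = M n by rewrite /M' ltnn.
(* Constraint (2) for the competitor is the same linear system with the same end values, hence has
   the same solution. *)
have M'E : \col_(i < n.-1) M' i.+1 = \col_(i < n.-1) M i.+1.
  rewrite ME -M'0 -M'N; apply/(Amx_system t_incr) => j jn.
  by apply/(deriv_spline_poly_jump _ jn); rewrite -!P'dE ?(ltnW jn)// Pd1.
have M'M j : (j <= n)%N -> M' j = M j.
  case: j => [//|j]; rewrite leq_eqVlt => /orP[/eqP -> //|jn].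
  have jn1 : (j < n.-1)%N by lia.
  by have /colP/(_ (Ordinal jn1)) := M'E; rewrite !mxE.
rewrite (cP' k kn s sk) P'E// -horner_spline_poly /spline_poly.
by rewrite !M'M// ltnW.
Qed.

End Splines.

(** The state is right-continuous at the nodes and has left limits there; continuous functions of
    the state inherit both. Applied to the output and its two derivatives. *)
Lemma ode_rnn_node_limits {R : realType} {m p n : nat} {t : nat -> R}
    {f cell} {X : nat -> 'cV[R]_p} {h : R -> 'cV[R]_m} (F : 'cV[R]_m -> R) :
  ode_rnn f cell n t X h -> continuous F ->
  has_node_limits (n := n) (t := t) (fun s => F (h s)).
Proof.
move=> hr cF k kn; have [_ hr0 hl _] := hr k kn.
split; first exact: (cvg_comp _ _ hr0 (cF _)).
have Fl : F (h s) @[s --> (t k.+1)^'-] --> F (lim (h s @[s --> (t k.+1)^'-])).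
  exact: (cvg_comp _ _ hl (cF _)).
by rewrite /left_lim (cvg_lim _ Fl).
Qed.

Theorem theorem1 (R : realType) (m p n : nat) (a b : R) (t : nat -> R)
    (f : 'cV[R]_m -> 'cV[R]_m) (g : 'cV[R]_m -> R)
    (cell : 'cV[R]_m -> 'cV[R]_p -> 'cV[R]_m)
    (X : nat -> 'cV[R]_p) (q : 'I_p) (h : R -> 'cV[R]_m)
    (n_gt0 : (0 < n)%N) (t0a : t 0%N = a) (tnb : t n = b)
    (t_incr : forall k, (k < n)%N -> t k < t k.+1)
    (f_C1 : is_C1 f) (g_C2 : is_C2 g)
    (h_rnn : ode_rnn f cell n t X h) :
  let x := fun k => X k q ord0 in
  let o := fun s => g (h s) in
  let o1 := fun s => output_d1 f g (h s) in
  let o2 := fun s => output_d2 f g (h s) in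
  let A := Amx n t in
  let d := dvec n t x o o1 o2 in
  let c := cubic_piece t x o o2 in
  [/\ A \in unitmx,
      (* end values M_0 = M_n = 0: these solve the problem exactly when the
         second derivative of the output vanishes at both ends *)
      forall M : nat -> R, M 0%N = 0 -> M n = 0 ->
        \col_(i < n.-1) M i.+1 = invmx A *m d ->
        (uniquely_given n t (smoothing n t x o) (c M)
         <-> o2 (t 0%N) = 0 /\ o2 (t n) = 0),
      (* the same problem for an arbitrary output *)
      forall M : nat -> R, M 0%N = - o2 (t 0%N) -> M n = - o2 (t n) ->
        \col_(i < n.-1) M i.+1 = invmx A *m (d - end_terms n t (M 0%N) (M n)) ->
        uniquely_given n t (smoothing n t x o) (c M) &
      (* M_0 = M_n = 0 for an arbitrary output, the end conditions being on the
         compensation *)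
      forall M : nat -> R, M 0%N = 0 -> M n = 0 ->
        \col_(i < n.-1) M i.+1 = invmx A *m d ->
        uniquely_given n t (smoothing_ends_c n t x o o2) (c M)].
Proof.
move=> x o o1 o2 A d c.
have dg : is_C1 g := g_C2.1.
have o_deriv k s : (k < n)%N -> s \in `]t k, t k.+1[ ->
    is_derive s (1 : R) o (o1 s).
  move=> kn sk; have [hd _ _ _] := h_rnn k kn.
  rewrite /o1 -(derive_output _ (dg.1 _)).
  exact: (is_derive_comp_path (dg.1 _) (hd s sk)).
have o1_deriv k s : (k < n)%N -> s \in `]t k, t k.+1[ ->
    is_derive s (1 : R) o1 (o2 s).
  move=> kn sk; have [hd _ _ _] := h_rnn k kn.
  rewrite /o2 -derive_output_d1//.
  exact: (is_derive_comp_path (differentiable_output_d1 _ f_C1 g_C2) (hd s sk)).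
have o_lim : has_node_limits (n := n) (t := t) o.
  apply: (ode_rnn_node_limits h_rnn) => y.
  exact/differentiable_continuous/dg.1.
have o1_lim : has_node_limits (n := n) (t := t) o1.
  apply: (ode_rnn_node_limits h_rnn) => y.
  exact/differentiable_continuous/differentiable_output_d1.
have o2_lim : has_node_limits (n := n) (t := t) o2.
  exact: (ode_rnn_node_limits h_rnn (continuous_output_d2 f_C1 g_C2)).
have outputE := end_values_outputP n_gt0 t_incr o_deriv o1_deriv o2_lim.
have spline := uniquely_given_spline (x := x) n_gt0 t_incr o_deriv o1_deriv
  o_lim o1_lim o2_lim.
have end_terms0 : end_terms n t 0 0 = 0.
  by apply/colP => i; rewrite !mxE !mulr0 !if_same addr0.
have smoothing_spline M : M 0%N = - o2 (t 0%N) -> M n = - o2 (t n) ->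
    \col_(i < n.-1) M i.+1 = invmx A *m (d - end_terms n t (M 0%N) (M n)) ->
    uniquely_given n t (smoothing n t x o) (c M).
  (* At [t n] the second derivative of the last piece is [M n] plus the jump of [o2]; with
     [M n = - o2 (t n)] this is minus the left limit of [o2], as required. *)
  move=> M0 Mn ME; apply: (spline M) ME => e P eP.
  rewrite (outputE _ _ _ _ eP) M0 Mn /jump.
  by split=> -[? ?]; split; lra.
split=> [||//|].
- exact: Amx_unit.
- move=> M M0 Mn ME; split=> [|[end0 endn]].
    (* With zero end values the second derivative of [e + o] tends to [o2 (t 0)] at the left end
       and, the jump being added to the left limit, to [o2 (t n)] at the right end. *)
    move=> [e [[_ eE] _ eM] ].
    have eP : has_pieces (n := n) (t := t) e
        (spline_poly (t := t) (o := o) (o2 := o2) x M).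
      by move=> k kn s sk; rewrite horner_spline_poly (eM k).
    have := (outputE _ _ _ _ eP).1 eE.
    have n1 : (n.-1 < n)%N by rewrite prednK.
    have := deriv2_spline_poly_right (o := o) (o2 := o2) x t_incr M n1.
    rewrite prednK// => ->.
    by rewrite deriv2_spline_poly_left M0 Mn /jump => -[? ?]; split; lra.
  apply: smoothing_spline; rewrite ?M0 ?Mn ?end0 ?endn ?oppr0//.
  by rewrite end_terms0 subr0.
- move=> M M0 Mn ME; apply: (spline M (fun e =>
    end_values n t (derive1n 2 e) 0 (jump t o2 n))) => [e P eP|].
    by rewrite (end_values_pieceP n_gt0 t_incr _ _ eP) M0 Mn add0r.
  by rewrite M0 Mn end_terms0 subr0.
Qed.
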